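(* Let $a\ge 1$ and $m\ge 0$ be integers. Let $f_0$ be defined by $f_0(1)=1$, $f_0(2)=a$, and $f_0(n+2)=(a-1)f_0(n+1)$ for $n\ge 1$, and let $f_m$ be the $m$-th invert transform of $f_0$. Then for every $n\ge 1$, the number $f_m(n)$ is the number of words of length $n-1$ over the alphabet $\{0,1,\ldots,a-1,a,\ldots,m+a-1\}$ such that no two adjacent letters from $\{0,1,\ldots,a-1\}$ are the same.
   Context: For an arithmetic function $f_0$ defined on the positive integers, the functions $f_m$ ($m\ge 1$) are defined recursively as iterated invert transforms: for $n\ge 1$, $f_m(n)=\sum_{k=1}^n\ \sum_{i_1+\cdots+i_k=n} f_{m-1}(i_1)f_{m-1}(i_2)\cdots f_{m-1}(i_k)$, where the inner sum is over positive integers $i_1,\ldots,i_k$. The condition on words means that no letter from $\{0,\ldots,a-1\}$ is immediately followed by the same letter; the letters $a,\ldots,m+a-1$ are unrestricted. *)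

(* Defs.v *)
From mathcomp Require Import all_boot.

Set Implicit Arguments.
Unset Strict Implicit.
Unset Printing Implicit Defensive.

(* Arithmetic functions are encoded as [nat -> nat]; the value at 0 is never
   used.  The parts of a composition of n into positive integers are at most n,
   so letting them range over ['I_n.+1] loses nothing. *)
Definition invert (f : nat -> nat) (n : nat) : nat :=
  \sum_(1 <= k < n.+1)
    \sum_(t : k.-tuple 'I_n.+1 |
            [forall j, 0 < tnth t j] && (\sum_(j < k) tnth t j == n))
      \prod_(j < k) f (tnth t j).

Definition iter_invert (m : nat) (f0 : nat -> nat) : nat -> nat :=
  iter m invert f0.

(* [sorted e w] only compares consecutive letters of w. *)
Definition good_word (a q : nat) (w : seq 'I_q) : bool :=
  sorted (fun x y : 'I_q => ~~ ((x < a) && (x == y))) w.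

(* Main.v *)
Require Import Defs.
From mathcomp Require Import all_boot.
From mathcomp Require Import zify.

(** Let W_m(n) be the number of good words of length n over m + a letters, so
    that f_m(n + 1) = W_m(n) is the claim.  Both sides of it are governed by
    simple recurrences.

    On the side of the transform, removing the first part of a composition
    gives g(n) = f(n) + sum_(1 <= i < n) f(i) g(n - i) for the invert transform
    g of f (invert_rec).  In terms of the generating functions F and G of f
    and g this says G = F / (1 - F), that is, 1 / G = 1 / F - 1.

    On the side of words, call the letters below a restricted.  A good word of
    length n can be prefixed by any letter, except by its own first letter if
    that letter is restricted.  Counting by first letters yields
      W_m(n + 2) + W_m(n + 1) = (m + a) W_m(n + 1) + m W_m(n)
    with W_m(0) = 1 and W_m(1) = m + a (words_rec).  Hence the shifted
    generating function F_m = sum_n W_m(n) x^(n + 1) satisfies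
      1 / F_m = (1 - (m + a - 1) x - m x^2) / (x (1 + x)) = 1 / F_0 - m,
    so that F_(m + 1) is the invert transform of F_m.  This last step is proved
    without generating functions, by checking that the convolution satisfies
    the recurrence of W_(m + 1) (words_invert_rec).  The theorem follows by
    induction on m; for m = 0 the recurrence is the one defining f_0. *)

(** * Tuples split at their first entry *)

Lemma sum_tuple_cons (T : finType) (k : nat) (P : pred (k.+1.-tuple T))
    (F : k.+1.-tuple T -> nat) :
  \sum_(t | P t) F t =
  \sum_(x : T) \sum_(t : k.-tuple T | P [tuple of x :: t]) F [tuple of x :: t].
Proof.
rewrite pair_big_dep /=.
rewrite (reindex (fun p : T * k.-tuple T => [tuple of p.1 :: p.2])) //=.
exists (fun t => (thead t, [tuple of behead t])) => [[x t] _ | t _] /=.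
  by congr pair; apply/val_inj.
by rewrite -tuple_eta.
Qed.

Lemma big_tuple0 (T : finType) (P : pred (0.-tuple T)) (F : 0.-tuple T -> nat) :
  \sum_(t | P t) F t = if P [tuple] then F [tuple] else 0.
Proof.
by rewrite big_mkcond (big_pred1 [tuple]) // => t; apply/esym/eqP/tuple0.
Qed.

Lemma forall_ord_recl (k : nat) (P : pred 'I_k.+1) :
  [forall j, P j] = P ord0 && [forall j, P (lift ord0 j)].
Proof.
apply/forallP/andP => [allP | [P0 /forallP PS] j].
  by split=> //; apply/forallP.
by case: (unliftP ord0 j) => [i|] ->.
Qed.

(** * Compositions and the invert transform *)

(** The sum of f(i_1) ... f(i_k) over the compositions i_1 + ... + i_k = n into
    positive parts, computed by removing the first part, here i.+1. *)
Fixpoint comp_weight (f : nat -> nat) (k n : nat) : nat :=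
  if k is k'.+1 then \sum_(i < n) f i.+1 * comp_weight f k' (n - i.+1)
  else n == 0.

(** Any bound N >= n on the parts gives the same set of compositions.  This
    freedom is what the induction requires: after the first part is removed,
    the remaining parts sum to less than n but still range over the same
    type. *)
Lemma comp_weight_tuples (f : nat -> nat) (N k n : nat) : n <= N ->
  \sum_(t : k.-tuple 'I_N.+1 |
          [forall j, 0 < tnth t j] && (\sum_(j < k) tnth t j == n))
    \prod_(j < k) f (tnth t j) = comp_weight f k n.
Proof.
elim: k n => [|k IHk] n le_nN.
  rewrite big_tuple0 !big_ord0 /= eq_sym.
  have -> : [forall j : 'I_0, 0 < tnth ([tuple] : 0.-tuple 'I_N.+1) j].
    by apply/forallP=> -[].
  by case: (n == 0).
rewrite sum_tuple_cons.
have consE (x : 'I_N.+1) :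
    \sum_(t : k.-tuple 'I_N.+1 |
            [forall j, 0 < tnth [tuple of x :: t] j] &&
            (\sum_(j < k.+1) tnth [tuple of x :: t] j == n))
       \prod_(j < k.+1) f (tnth [tuple of x :: t] j)
    = if 0 < x <= n then f x * comp_weight f k (n - x) else 0.
  case: ifP => [/andP[x_gt0 le_xn] | x_out].
    rewrite -IHk ?big_distrr /=; last lia.
    apply: eq_big => [t | t _].
      rewrite forall_ord_recl big_ord_recl tnth0 x_gt0 /=.
      congr (_ && _); first by apply: eq_forallb => j; rewrite tnthS.
      rewrite (eq_bigr (fun j => nat_of_ord (tnth t j))) => [|j _]; last first.
        by rewrite tnthS.
      by apply/eqP/eqP; lia.
    rewrite big_ord_recl tnth0; congr (_ * _).
    by apply: eq_bigr => j _; rewrite tnthS.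
  (* A first entry that is zero or exceeds n begins no composition of n. *)
  rewrite big_pred0 // => t; apply/negP => /andP[/forallP/(_ ord0)].
  rewrite big_ord_recl !tnth0 => x_gt0 /eqP sum_n.
  by move/negP: x_out; apply; lia.
rewrite (eq_bigr _ (fun x _ => consE x)) big_ord_recl /= add0n.
by rewrite (big_ord_widen N (fun i => f i.+1 * comp_weight f k (n - i.+1))) //
           [RHS]big_mkcond.
Qed.

Lemma comp_weight_gt (f : nat -> nat) (k n : nat) : n < k ->
  comp_weight f k n = 0.
Proof.
elim: k n => // k IHk n lt_nk /=.
by rewrite big1 // => i _; rewrite IHk ?muln0 //; have := ltn_ord i; lia.
Qed.

(** A composition of n has between 1 and n parts, so extending the range of k
    to 0 and up to any N >= n adds only zeros.  A common range for all n allows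
    exchanging the sum over k with the sum over the first part. *)
Lemma invert_comp_weight (f : nat -> nat) (n N : nat) : 0 < n <= N ->
  invert f n = \sum_(k < N.+1) comp_weight f k n.
Proof.
case/andP=> n_gt0 le_nN; rewrite /invert.
rewrite (eq_bigr (fun k => comp_weight f k n)) => [|k _]; last first.
  exact: comp_weight_tuples.
rewrite big_add1 big_mkord big_ord_recl /= eqn0Ngt n_gt0 add0n.
rewrite (big_ord_widen N (fun k => comp_weight f k.+1 n)) // big_mkcond.
apply: eq_bigr => k _; case: ifPn => //; rewrite -leqNgt => le_nk.
by rewrite -[RHS]/(comp_weight f k.+1 n) comp_weight_gt.
Qed.

(** Summing over the number of parts the decomposition of a composition by its
    first part i.+1: either it is the only part, or the others form an
    arbitrary composition of n - i. *)
Lemma invert_rec (f : nat -> nat) (n : nat) :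
  invert f n.+1 = f n.+1 + \sum_(i < n) f i.+1 * invert f (n - i).
Proof.
rewrite (invert_comp_weight f n.+1 n.+1) ?leqnn // big_ord_recl /= add0n.
(* The last index i = n is the composition with the single part n.+1. *)
rewrite exchange_big big_ord_recr /= addnC; congr (_ + _).
  rewrite -big_distrr /= subnn big_ord_recl /= big1 ?addn0 ?muln1 // => k _.
  by rewrite big_ord0.
apply: eq_bigr => i _; rewrite -big_distrr /= subSS.
by rewrite (invert_comp_weight f _ n) //; have := ltn_ord i; lia.
Qed.

(** * Counting words by their first letter *)

Definition words (a q n : nat) : nat :=
  #|[set w : n.-tuple 'I_q | good_word a w]|.

(** The length n does not include the first letter x. *)
Definition words_from (a q n : nat) (x : 'I_q) : nat :=
  #|[set w : n.-tuple 'I_q | good_word a (x :: w)]|.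

Lemma card_tuple_cons (T : finType) (n : nat) (P : pred (seq T)) :
  #|[set w : n.+1.-tuple T | P w]| =
  \sum_(x : T) #|[set w : n.-tuple T | P (x :: w)]|.
Proof.
rewrite cardsE -sum1_card sum_tuple_cons.
by apply: eq_bigr => x _; rewrite cardsE -sum1_card.
Qed.

Lemma words_from_free (a q n : nat) (x : 'I_q) : a <= x ->
  words_from a q n x = words a q n.
Proof.
move=> le_ax; apply: eq_card => w; rewrite !inE /good_word /=.
by case: (tval w) => //= y s; rewrite ltnNge le_ax.
Qed.

(** After a restricted letter x comes any nonempty good word, except those
    that start with x. *)
Lemma words_from_rec (a q n : nat) (x : 'I_q) : x < a ->
  words_from a q n.+1 x + words_from a q n x = words a q n.+1.
Proof.
move=> lt_xa; rewrite /words_from /words !card_tuple_cons.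
rewrite (bigD1 x) //= [RHS](bigD1 x) //= addnC; congr (_ + _).
rewrite [X in X + _]eq_card0 => [|w]; last first.
  by rewrite !inE /good_word /= lt_xa eqxx.
apply: eq_bigr => y ne_yx; apply: eq_card => w.
by rewrite !inE /good_word /= [x == y]eq_sym (negbTE ne_yx) andbF.
Qed.

Lemma words0 (a q : nat) : words a q 0 = 1.
Proof. by rewrite /words cardsE -sum1_card big_tuple0. Qed.

Lemma words1 (a q : nat) : words a q 1 = q.
Proof.
rewrite /words (eq_card (B := predT)) ?card_tuple ?card_ord ?expn1 // => w.
by rewrite !inE; case: w => -[|x [|]].
Qed.

(** Let R(k) be the number of good words of length k.+1 with restricted first
    letter.  Then W(k.+1) = R(k) + m W(k), since an unrestricted letter may
    precede any good word, and R(n.+1) + R(n) = a W(n.+1) by summing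
    words_from_rec over the restricted letters.  Eliminating R gives the
    recurrence, in a form free of subtraction. *)
Lemma words_rec (a m n : nat) :
  words a (m + a) n.+2 + words a (m + a) n.+1 =
  (m + a) * words a (m + a) n.+1 + m * words a (m + a) n.
Proof.
set q := m + a.
pose R := \sum_(x < q | x < a) words_from a q n x.
have card_low : #|[pred x : 'I_q | x < a]| = a.
  rewrite -sum1_card (big_ord_narrow (leq_addl m a)) sum1_card.
  exact: card_ord.
have card_high : #|[pred x : 'I_q | ~~ (x < a)]| = m.
  have := cardC [pred x : 'I_q | x < a]; rewrite card_ord card_low.
  by rewrite (eq_card (B := [pred x : 'I_q | ~~ (x < a)])) // /q; lia.
have split_first k : words a q k.+1 =
    \sum_(x < q | x < a) words_from a q k x + m * words a q k.
  rewrite {1}/words card_tuple_cons (bigID (fun x : 'I_q => x < a)) /=.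
  congr (_ + _); rewrite (eq_bigr (fun=> words a q k)) => [|x].
    by rewrite sum_nat_const card_high.
  by rewrite -leqNgt; apply: words_from_free.
have low_rec : \sum_(x < q | x < a) words_from a q n.+1 x + R =
    a * words a q n.+1.
  rewrite -big_split /= (eq_bigr (fun=> words a q n.+1)) => [|x].
    by rewrite sum_nat_const card_low.
  exact: words_from_rec.
have := split_first n.+1; have := split_first n; rewrite -/R.
rewrite (mulnDl m a); lia.
Qed.

(** Both sides have the same two initial values and satisfy the same
    second-order recurrence: with A = W_m, B = W_(m + 1), S their convolution
    and C = A + S the right-hand side, the recurrence of A gives
      C(n + 2) + C(n + 1)
        = (m + a) C(n + 1) + m C(n) + B(n + 1) + B(n),
    which becomes that of B once C(n + 1) = B(n + 1) and C(n) = B(n). *)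
Lemma words_invert_rec (a m n : nat) :
  words a (m.+1 + a) n =
  words a (m + a) n +
  \sum_(i < n) words a (m + a) i * words a (m.+1 + a) (n - i.+1).
Proof.
set A := words a (m + a); set B := words a (m.+1 + a).
pose S n := \sum_(i < n) A i * B (n - i.+1).
rewrite -/(S n).
suff : B n = A n + S n /\ B n.+1 = A n.+1 + S n.+1 by case.
elim: n => [|n [IHn IHn1]].
  rewrite /S big_ord0 big_ord1 /A /B !words0 !words1; lia.
split=> //.
(* T and U are what is left of S n.+1 and S n.+2 once their first one and two
   terms are removed; these are the sums to which the recurrence of A applies
   term by term. *)
pose T := \sum_(i < n) A i.+1 * B (n - i.+1).
pose U := \sum_(i < n) A i.+2 * B (n - i.+1).
have S1 : S n.+1 = B n + T.
  by rewrite /S big_ord_recl /A words0 mul1n subSS subn0.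
have S2 : S n.+2 = B n.+1 + ((m + a) * B n + U).
  by rewrite /S 2!big_ord_recl /A /= words0 words1 mul1n !subSS !subn0.
have UT : U + T = (m + a) * T + m * S n.
  rewrite -big_split !big_distrr -big_split /=; apply: eq_bigr => i _.
  by rewrite -mulnDl words_rec mulnDl !mulnA.
have recA := words_rec a m n; have recB := words_rec a m.+1 n.
move: recA recB; rewrite -/A -/B => recA recB.
nia.
Qed.

Theorem proposition3 (a m : nat) (ha : 1 <= a) (f0 : nat -> nat)
    (hf1 : f0 1 = 1) (hf2 : f0 2 = a)
    (hfrec : forall n : nat, 1 <= n -> f0 (n + 2) = (a - 1) * f0 (n + 1)) :
  forall n : nat, 1 <= n ->
    iter_invert m f0 n =
      #|[set w : (n - 1).-tuple 'I_(m + a) | good_word a w]|.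
Proof.
move=> [//|n] _; rewrite subn1 /= -/(words a (m + a) n).
elim: m n => [|m IHm] n.
  rewrite /iter_invert /=; case: n => [|n]; first by rewrite words0.
  elim: n => [|n IHn]; first by rewrite words1.
  have := words_rec a 0 n; have := hfrec n.+1 isT.
  by rewrite addn2 addn1 IHn; nia.
elim/ltn_ind: n => n IHn.
rewrite words_invert_rec /iter_invert iterS invert_rec -/(iter_invert m f0).
rewrite IHm; congr (_ + _); apply: eq_bigr => i _.
rewrite IHm -IHn; last by have := ltn_ord i; lia.
by rewrite subnSK.
Qed.
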